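(* Let $G$ be a finite simple graph with $n$ vertices and $m$ edges, where $n\geq 3$. For $u\in V(G)$ let $\delta_G(u)$ be the neighborhood degree of $u$, let $n_i$ be the number of vertices of neighborhood degree $i$, and let $\delta$ and $\Delta$ be the minimum and maximum neighborhood degree of $G$. Assume $\delta\neq\Delta$. Let $\alpha\in\mathbb{R}$ with $\alpha\notin\{0,1\}$; when $\alpha<0$ assume moreover that $\delta\geq 1$ (equivalently, $G$ has no isolated vertices). Put $s_\alpha=\frac{\Delta^\alpha-\delta^\alpha}{\Delta-\delta}$ and let $M_1=M_1(G)=\sum_{u\in V(G)}d(u)^2$. Then: \begin{enumerate} \item $NM_\alpha(G)=n\delta^\alpha+(M_1-n\delta)s_\alpha+\sum_{i=1}^{\Delta-\delta-1}n_{\delta+i}\left[(\delta+i)^\alpha-\delta^\alpha-i s_\alpha\right].$ Moreover, if $\alpha<0$ or $\alpha>1$, then $(\delta+i)^\alpha-\delta^\alpha-i s_\alpha\leq 0$ for $1\leq i\leq \Delta-\delta-1$, and if $0<\alpha<1$, then $(\delta+i)^\alpha-\delta^\alpha-i s_\alpha\geq 0$ for $1\leq i\leq\Delta-\delta-1$. \item $NM_\alpha(G)=n\delta^\alpha+(M_1-n\delta)\big((\delta+1)^\alpha-\delta^\alpha\big)+\sum_{i=2}^{\Delta-\delta}n_{\delta+i}\left[(\delta+i)^\alpha-\delta^\alpha-i\big((\delta+1)^\alpha-\delta^\alpha\big)\right].$ Moreover, if $\alpha<0$ or $\alpha>1$, then $(\delta+i)^\alpha-\delta^\alpha-i((\delta+1)^\alpha-\delta^\alpha)\geq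 0$ for $2\leq i\leq\Delta-\delta$, and if $0<\alpha<1$, then $(\delta+i)^\alpha-\delta^\alpha-i((\delta+1)^\alpha-\delta^\alpha)\leq 0$ for $2\leq i\leq \Delta-\delta$. \end{enumerate}
   Context: For a vertex $u$ of a graph $G$, $d(u)$ denotes its degree and the neighborhood degree $\delta_G(u)$ is the sum of the degrees of the vertices adjacent to $u$. The first Zagreb index is $M_1(G)=\sum_{u\in V(G)}d(u)^2$. For a real number $\alpha\notin\{0,1\}$, the general neighborhood Zagreb index is $NM_\alpha(G)=\sum_{u\in V(G)}\delta_G(u)^\alpha$. *)

(* Defs.v *)
From mathcomp Require Import all_boot all_order all_algebra.
From mathcomp Require Import reals exp.

Set Implicit Arguments.
Unset Strict Implicit.
Unset Printing Implicit Defensive.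

Local Open Scope ring_scope.

(* A finite simple graph is a finite vertex type [T] with an adjacency
   relation [e : rel T] that is symmetric and irreflexive. *)

Definition edges (T : finType) (e : rel T) : {set {set T}} :=
  [set A : {set T} | [exists u, exists v, e u v && (A == [set u; v])]].

Definition deg (T : finType) (e : rel T) (u : T) : nat := #|[set v | e u v]|.

Definition ndeg (T : finType) (e : rel T) (u : T) : nat :=
  (\sum_(v | e u v) deg e v)%N.

Definition max_ndeg (T : finType) (e : rel T) : nat :=
  (\max_(u : T) ndeg e u)%N.

(* The default value [max_ndeg e] bounds every [ndeg e u] from above, so it does
   not affect the minimum as soon as [T] is inhabited. *)
Definition min_ndeg (T : finType) (e : rel T) : nat :=
  \big[minn/max_ndeg e]_(u : T) ndeg e u.

Definition nb_ndeg (T : finType) (e : rel T) (i : nat) : nat :=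
  #|[set u | ndeg e u == i]|.

Definition zagreb1 (T : finType) (e : rel T) : nat :=
  (\sum_(u : T) deg e u ^ 2)%N.

(* [powR] has [0 `^ a = 0] for every [a != 0], which is the usual value for
   [a > 0]; for [a < 0] this index is only meaningful when every [ndeg e u] is
   positive. *)
Definition gnzagreb (R : realType) (T : finType) (e : rel T) (alpha : R) : R :=
  \sum_(u : T) (ndeg e u)%:R `^ alpha.

(* Main.v *)
Require Import Defs.
From mathcomp Require Import all_boot all_order all_algebra.
From mathcomp Require Import reals exp.
From mathcomp Require Import ring lra zify.

(** Grouping the vertices by neighborhood degree and using that the neighborhood
    degrees sum to [M_1] gives, for every function [f] and every slope [c],
    [\sum_u f (ndeg u) = n f(delta) + (M_1 - n delta) c
       + \sum_i n_(delta+i) (f(delta+i) - f(delta) - i c)].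
    The chord slope over [[delta, Delta]] kills the terms [i = 0] and
    [i = Delta - delta], the slope over [[delta, delta+1]] those with [i = 0, 1].
    The signs of the remaining brackets are the three-chord inequality for
    [x `^ alpha], which follows from Bernoulli's inequality, itself a consequence
    of [ln x <= x - 1]. *)

Set Implicit Arguments.
Unset Strict Implicit.
Unset Printing Implicit Defensive.

Import Order.TTheory GRing.Theory Num.Theory.
Local Open Scope ring_scope.

Section PowerChord.
Variable R : realType.
Implicit Types a r x y z : R.

Lemma ln_le_subr1 x : 0 < x -> ln x <= x - 1.
Proof. by move=> x0; rewrite -{1}(subrKC 1 x) le_ln1Dx //; lra. Qed.

Lemma le_powR_ln r a x : 0 < r -> 0 < x -> ln x <= a * ln r -> x <= r `^ a.
Proof.
by move=> r0 x0 h; rewrite /powR gt_eqF // -[x]lnK ?posrE // ler_expR.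
Qed.

Lemma ge_powR_ln r a x : 0 < r -> 0 < x -> a * ln r <= ln x -> r `^ a <= x.
Proof.
by move=> r0 x0 h; rewrite /powR gt_eqF // -[leRHS]lnK ?posrE // ler_expR.
Qed.

(** With [w = 1 + a * (r - 1)] positive, the claim is [ln w <= a * ln r]. For [a < 0] it follows
    from [ln w <= w - 1 = a * (r - 1)]. For [1 < a] it follows from [ln (w / r) <= w / r - 1 = (a -
    1) * (1 - r^-1)], bounded in turn by [(a - 1) * ln r]. *)
Lemma bernoulli_powR_ge r a : 0 <= r -> (a < 0 -> 0 < r) -> a < 0 \/ 1 < a ->
  1 + a * (r - 1) <= r `^ a.
Proof.
move=> r_ge0 r_gt0 ha.
have [w0|w0] := leP (1 + a * (r - 1)) 0; first exact: le_trans (powR_ge0 _ _).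
(* If [1 < a], then [r = 0] would make the left side [1 - a < 0]. *)
have {r_ge0 r_gt0} r0 : 0 < r.
  case: ha => [|a1]; first exact: r_gt0.
  rewrite lt_def r_ge0 andbT; apply: contraTneq w0 => ->.
  by rewrite -leNgt; lra.
apply: le_powR_ln => //; case: ha => ha.
  have := ln_le_subr1 w0.
  have : 0 <= - a * (r - 1 - ln r).
    by apply: mulr_ge0; [lra | rewrite subr_ge0 ln_le_subr1].
  by lra.
have rV0 : 0 < r^-1 by rewrite invr_gt0.
have := ln_le_subr1 (mulr_gt0 w0 rV0).
have : 0 <= (a - 1) * (r^-1 - 1 - ln r^-1).
  by apply: mulr_ge0; [lra | rewrite subr_ge0 ln_le_subr1].
rewrite ln_div ?posrE // lnV ?posrE //.
have -> : (1 + a * (r - 1)) / r = a - (a - 1) * r^-1.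
  by field; rewrite gt_eqF.
by lra.
Qed.

(** Weighted AM-GM for [r] and [1] with weights [a] and [1 - a]: dividing both by their mean [w] and
    averaging [ln x <= x - 1] gives [a * ln r - ln w <= 0]. *)
Lemma bernoulli_powR_le r a : 0 <= r -> 0 < a < 1 -> r `^ a <= 1 + a * (r - 1).
Proof.
move=> r_ge0 /andP[a0 a1]; have [->|rN0] := eqVneq r 0.
  by rewrite powR0 ?gt_eqF //; lra.
have r0 : 0 < r by rewrite lt_def rN0.
have w0 : 0 < 1 + a * (r - 1) by have := mulr_gt0 a0 r0; lra.
apply: ge_powR_ln => //; set w := 1 + _ in w0 *.
have wV0 : 0 < w^-1 by rewrite invr_gt0.
have : 0 <= a * (r / w - 1 - ln (r / w)).
  by apply: mulr_ge0; [lra | rewrite subr_ge0 ln_le_subr1 ?mulr_gt0].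
have : 0 <= (1 - a) * (w^-1 - 1 - ln w^-1).
  by apply: mulr_ge0; [lra | rewrite subr_ge0 ln_le_subr1].
have : w * w^-1 = 1 by rewrite divff ?gt_eqF.
rewrite {1}/w ln_div ?posrE // lnV ?posrE //; lra.
Qed.

Lemma powR_divK x y a : 0 < x -> 0 <= y -> y `^ a = x `^ a * (y / x) `^ a.
Proof.
move=> x0 y0; rewrite -powRM ?divr_ge0 ?(ltW x0) //.
by rewrite mulrC divfK ?gt_eqF.
Qed.

(** Bernoulli at [r = y / x], scaled by [x]^ a[; the slope]a * (x [^ a / x)] is the derivative at
    [x]. *)
Lemma powR_tangent_le x y a : 0 < x -> 0 <= y -> (a < 0 -> 0 < y) ->
  a < 0 \/ 1 < a -> x `^ a + a * (x `^ a / x) * (y - x) <= y `^ a.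
Proof.
move=> x0 y0 hy ha; rewrite (powR_divK a x0 y0).
have -> : x `^ a + a * (x `^ a / x) * (y - x) =
    x `^ a * (1 + a * (y / x - 1)) by field; rewrite gt_eqF.
rewrite ler_wpM2l ?powR_ge0 // bernoulli_powR_ge ?divr_ge0 ?(ltW x0) //.
by move=> /hy y_gt0; rewrite divr_gt0.
Qed.

Lemma powR_tangent_ge x y a : 0 < x -> 0 <= y -> 0 < a < 1 ->
  y `^ a <= x `^ a + a * (x `^ a / x) * (y - x).
Proof.
move=> x0 y0 ha; rewrite (powR_divK a x0 y0).
have -> : x `^ a + a * (x `^ a / x) * (y - x) =
    x `^ a * (1 + a * (y / x - 1)) by field; rewrite gt_eqF.
by rewrite ler_wpM2l ?powR_ge0 // bernoulli_powR_le ?divr_ge0 ?(ltW x0).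
Qed.

(** The tangent at [y] is evaluated at [x] and [z]. With weights [z - y] and [y - x] the slope terms
    cancel. *)
Lemma powR_chord_le x y z a : 0 <= x -> (a < 0 -> 0 < x) -> x < y -> y <= z ->
  a < 0 \/ 1 < a ->
  (z - x) * y `^ a <= (z - y) * x `^ a + (y - x) * z `^ a.
Proof.
move=> x0 hx xy yz ha; have y0 : 0 < y := le_lt_trans x0 xy.
have z0 : 0 < z := lt_le_trans y0 yz.
have := ler_wpM2l _ (@powR_tangent_le y x a y0 x0 hx ha).
move=> /(_ (z - y)); rewrite subr_ge0 => /(_ yz).
have := ler_wpM2l _ (@powR_tangent_le y z a y0 (ltW z0) (fun=> z0) ha).
move=> /(_ (y - x)); rewrite subr_ge0 => /(_ (ltW xy)).
by lra.
Qed.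

Lemma powR_chord_ge x y z a : 0 <= x -> x < y -> y <= z -> 0 < a < 1 ->
  (z - y) * x `^ a + (y - x) * z `^ a <= (z - x) * y `^ a.
Proof.
move=> x0 xy yz ha; have y0 : 0 < y := le_lt_trans x0 xy.
have z0 : 0 < z := lt_le_trans y0 yz.
have := ler_wpM2l _ (@powR_tangent_ge y x a y0 x0 ha).
move=> /(_ (z - y)); rewrite subr_ge0 => /(_ yz).
have := ler_wpM2l _ (@powR_tangent_ge y z a y0 (ltW z0) ha).
move=> /(_ (y - x)); rewrite subr_ge0 => /(_ (ltW xy)).
by lra.
Qed.

End PowerChord.

Section NeighborhoodDegree.
Variables (T : finType) (e : rel T).

(** Double counting: [deg e v] is contributed once by each of the [deg e v] neighbors of [v]. *)
Lemma sum_ndeg : symmetric e -> (\sum_u ndeg e u = zagreb1 e)%N.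
Proof.
move=> e_sym; rewrite /ndeg /zagreb1.
rewrite (exchange_big_dep xpredT) //=; apply: eq_bigr => v _.
rewrite sum_nat_const -mulnn; congr (_ * _)%N.
by rewrite /deg; apply: eq_card => u; rewrite !inE unfold_in e_sym.
Qed.

Lemma ndeg_le_max u : (ndeg e u <= max_ndeg e)%N.
Proof. exact: (leq_bigmax u). Qed.

Lemma min_ndeg_le u : (min_ndeg e <= ndeg e u)%N.
Proof. by rewrite -leEnat; exact: bigmin_le. Qed.

Lemma sum_by_ndeg (V : nmodType) (f : nat -> V) :
  \sum_u f (ndeg e u) =
  \sum_(0 <= i < (max_ndeg e - min_ndeg e).+1)
     f (min_ndeg e + i)%N *+ nb_ndeg e (min_ndeg e + i).
Proof.
rewrite big_mkord.
(* The offset above the minimum is at most [max_ndeg e - min_ndeg e], so [inord] preserves it. *)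
pose p u : 'I_(max_ndeg e - min_ndeg e).+1 := inord (ndeg e u - min_ndeg e).
have pE u : (min_ndeg e + p u)%N = ndeg e u.
  by rewrite inordK ?subnKC ?min_ndeg_le // ltnS leq_sub2r ?ndeg_le_max.
rewrite (partition_big p xpredT) //=; apply: eq_bigr => i _.
rewrite (eq_bigr (fun=> f (min_ndeg e + i)%N)); last first.
  by move=> u /eqP <-; rewrite pE.
rewrite sumr_const; congr (_ *+ _).
rewrite /nb_ndeg; apply: eq_card => u; rewrite !inE unfold_in -pE eqn_add2l.
exact: val_eqE.
Qed.

Lemma sum_ndeg_slope (R : pzRingType) (f : nat -> R) (c : R) : symmetric e ->
  \sum_u f (ndeg e u) =
  #|T|%:R * f (min_ndeg e) + ((zagreb1 e)%:R - #|T|%:R * (min_ndeg e)%:R) * c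
  + \sum_(0 <= i < (max_ndeg e - min_ndeg e).+1)
      (nb_ndeg e (min_ndeg e + i))%:R
      * (f (min_ndeg e + i)%N - f (min_ndeg e) - i%:R * c).
Proof.
move=> e_sym; set d := min_ndeg e.
(* Grouping is applied to the deviation of [f] from the line of slope [c] through [d]. The truncated
   [k - d] is exact, as every neighborhood degree is at least [d]. *)
have := sum_by_ndeg (fun k => f k - f d - (k - d)%:R * c).
under [in RHS]eq_bigr => i _ do rewrite addKn -[_ *+ nb_ndeg _ _]mulr_natl.
move=> <-; rewrite !sumrB sumr_const -mulr_suml.
have -> : \sum_u (ndeg e u - d)%:R = (zagreb1 e)%:R - #|T|%:R * d%:R :> R.
  under eq_bigr => u _ do rewrite natrB ?min_ndeg_le //.
  by rewrite sumrB sumr_const -natr_sum sum_ndeg // mulr_natl.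
by rewrite -[f d *+ _]mulr_natl addrC -[_ - _ - _]addrA -opprD subrK.
Qed.

End NeighborhoodDegree.

Theorem theorem3p2 (R : realType) (T : finType) (e : rel T)
    (e_sym : symmetric e) (e_irr : irreflexive e)
    (n m delta Delta : nat)
    (hn : #|T| = n) (hm : #|edges e| = m) (n_ge3 : (3 <= n)%N)
    (hdelta : delta = min_ndeg e) (hDelta : Delta = max_ndeg e)
    (delta_neq_Delta : delta <> Delta)
    (alpha : R) (alpha_neq0 : alpha <> 0) (alpha_neq1 : alpha <> 1)
    (delta_ge1 : alpha < 0 -> (1 <= delta)%N) :
  let pw (k : nat) : R := k%:R `^ alpha in
  let s : R := (pw Delta - pw delta) / (Delta%:R - delta%:R) in
  let t : R := pw (delta + 1)%N - pw delta in
  let M1 : R := (zagreb1 e)%:R in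
  (gnzagreb e alpha =
      n%:R * pw delta + (M1 - n%:R * delta%:R) * s
      + \sum_(1 <= i < Delta - delta)
          (nb_ndeg e (delta + i))%:R
          * (pw (delta + i)%N - pw delta - i%:R * s)
   /\ (alpha < 0 \/ 1 < alpha ->
       forall i : nat, (1 <= i <= Delta - delta - 1)%N ->
         pw (delta + i)%N - pw delta - i%:R * s <= 0)
   /\ (0 < alpha < 1 ->
       forall i : nat, (1 <= i <= Delta - delta - 1)%N ->
         0 <= pw (delta + i)%N - pw delta - i%:R * s))
  /\
  (gnzagreb e alpha =
      n%:R * pw delta + (M1 - n%:R * delta%:R) * t
      + \sum_(2 <= i < (Delta - delta).+1)
          (nb_ndeg e (delta + i))%:R
          * (pw (delta + i)%N - pw delta - i%:R * t)
   /\ (alpha < 0 \/ 1 < alpha ->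
       forall i : nat, (2 <= i <= Delta - delta)%N ->
         0 <= pw (delta + i)%N - pw delta - i%:R * t)
   /\ (0 < alpha < 1 ->
       forall i : nat, (2 <= i <= Delta - delta)%N ->
         pw (delta + i)%N - pw delta - i%:R * t <= 0)).
Proof.
move=> pw s t M1.
have ltdD : (delta < Delta)%N.
  have [u _] : exists u : T, u \in T by apply/card_gt0P; rewrite hn; lia.
  have := min_ndeg_le e u; have := ndeg_le_max e u; lia.
have D0 : (Delta%:R - delta%:R : R) > 0 by rewrite subr_gt0 ltr_nat.
have DsE : (Delta%:R - delta%:R) * s = pw Delta - pw delta.
  by rewrite /s mulrC divfK ?gt_eqF.
have d0 : 0 <= delta%:R :> R by exact: ler0n.
have dpos : alpha < 0 -> 0 < delta%:R :> R by rewrite ltr0n.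
have sumE c : gnzagreb e alpha = _ := sum_ndeg_slope pw c e_sym.
rewrite hn -hdelta -hDelta in sumE.
split; (split; last split).
(* The two end terms, [i = Delta - delta] and [i = 0], are split off and vanish. *)
- rewrite (sumE s) -/M1 big_nat_recr //= big_ltn ?subn_gt0 //.
  rewrite addn0 subrr mul0r subrr mulr0 add0r subnKC ?(ltnW ltdD) //.
  by rewrite natrB ?(ltnW ltdD) // DsE subrr mulr0 addr0.
(* Multiplying by [Delta - delta > 0] clears the denominator of [s], leaving the chord inequality at
   [delta], [delta + i], [Delta]. *)
- move=> ha i hi; rewrite -(pmulr_rle0 _ D0).
  have := @powR_chord_le R delta%:R (delta + i)%:R Delta%:R alpha d0 dpos.
  rewrite ltr_nat ler_nat => /(_ ltac:(lia) ltac:(lia) ha).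
  rewrite -!/(pw _) natrD; nra.
- move=> ha i hi; rewrite -(pmulr_rge0 _ D0).
  have := @powR_chord_ge R delta%:R (delta + i)%:R Delta%:R alpha d0.
  rewrite ltr_nat ler_nat => /(_ ltac:(lia) ltac:(lia) ha).
  rewrite -!/(pw _) natrD; nra.
- rewrite (sumE t) -/M1 big_ltn // big_ltn ?ltnS ?subn_gt0 //.
  by rewrite addn0 !subrr !mul0r !mul1r !subrr !mulr0 !add0r.
(* At [delta], [delta + 1], [delta + i] the first gap is 1, so no denominator has to be cleared. *)
- move=> ha i hi.
  have := @powR_chord_le R delta%:R (delta + 1)%:R (delta + i)%:R alpha d0 dpos.
  rewrite ltr_nat ler_nat => /(_ ltac:(lia) ltac:(lia) ha).
  rewrite -!/(pw _) /t !natrD; lra.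
- move=> ha i hi.
  have := @powR_chord_ge R delta%:R (delta + 1)%:R (delta + i)%:R alpha d0.
  rewrite ltr_nat ler_nat => /(_ ltac:(lia) ltac:(lia) ha).
  rewrite -!/(pw _) /t !natrD; lra.
Qed.
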